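(* Let $F$ be an algebraically closed field of characteristic $0$ and let $n\ge2$. The universal associative envelope $\mathfrak{A}$ of the anti-Jordan triple system $\mathfrak{J}$ of all $n\times n$ matrices over $F$ decomposes, as an associative algebra, as $$\mathfrak{A}\;\cong\; F\oplus M_{n,n}(F)\oplus M_{n,n}(F)\oplus M_{n,n}(F)\oplus M_{n,n}(F),$$ where $M_{n,n}(F)$ is the ordinary associative algebra of all $n\times n$ matrices over $F$.
   Context: $\mathfrak{J}$ is the space of $n\times n$ matrices over $F$ with trilinear product $\langle a,b,c\rangle=abc-cba$. With $\Omega=\{1,\dots,n\}$, its (unital) universal associative envelope is $\mathfrak{A}=F\langle X\rangle/I$, where $F\langle X\rangle$ is the free unital associative algebra on symbols $X=\{e_{i,j}\}_{i,j\in\Omega}$ (with $e_{i,j}$ corresponding to the matrix unit $E_{i,j}$), and $I$ is the two-sided ideal generated by all elements $e_{i,j}e_{k,\ell}e_{m,t}-e_{m,t}e_{k,\ell}e_{i,j}-\delta_{j,k}\delta_{\ell,m}e_{i,t}+\delta_{t,k}\delta_{\ell,i}e_{m,j}$ for $i,j,k,\ell,m,t\in\Omega$. *)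

(* Defs.v *)
From HB Require Import structures.
From mathcomp Require Import all_boot all_order all_algebra.
From mathcomp Require Import boolp classical_sets.
From mathcomp Require Import finmap.
From mathcomp.multinomials Require Import monalg.

Set Implicit Arguments.
Unset Strict Implicit.
Unset Printing Implicit Defensive.

Import GRing.Theory.
Local Open Scope ring_scope.
Local Open Scope classical_set_scope.
Local Open Scope quotient_scope.

Lemma malg_scalerAr (F : comNzRingType) (K : monomType) (k : F)
  (x y : {malg F[K]}) : k *: (x * y) = x * (k *: y).
Proof.
apply/malgP => w; rewrite mcoeffZ.
rewrite (@mcoeffMlw _ _ _ _ x y w (fsubset_refl _) (fsubset_refl _)).
rewrite (@mcoeffMlw _ _ _ _ x (k *: y) w (fsubset_refl _) (msuppZ_le k y)).
rewrite mulr_sumr; apply: eq_bigr => u _.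
rewrite mulr_sumr; apply: eq_bigr => v _.
by rewrite mcoeffZ mulrnAr mulrCA.
Qed.

Section FreeAlgebra.
Variables (F : comNzRingType) (X : choiceType).

(* Monoid algebra over the free monoid {fmonom X}, whose elements are the
   noncommutative words in X. *)
Definition free_alg := {malg F[{fmonom X}]}.

HB.instance Definition _ := GRing.Lalgebra.on free_alg.

Fact free_alg_scalerAr (k : F) (x y : free_alg) : k *: (x * y) = x * (k *: y).
Proof. exact: malg_scalerAr. Qed.

HB.instance Definition _ :=
  GRing.Lalgebra_isAlgebra.Build F free_alg free_alg_scalerAr.

Definition free_gen (x : X) : free_alg := << fmu x >>.

Lemma free_alg_augmentation : exists eps : free_alg -> F,
  [/\ {morph eps : x y / x + y}, {morph eps : x / - x},
      forall c x, eps (c *: x) = c * eps x, monoid_morphism eps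
    & forall x, eps (free_gen x) = 0].
Proof.
exists (@mcoeff {fmonom X} F mone); split.
- exact: mcoeffD.
- exact: mcoeffN.
- by move=> c x; rewrite [LHS]mcoeffZ.
- have [epsM eps1] := @mcoeff1g_is_multiplicative {fmonom X} F.
  by split; [exact: eps1 | exact: epsM].
- by move=> x; rewrite [LHS]mcoeffU1 fm1_eq1.
Qed.

End FreeAlgebra.

Section TwoSidedIdeal.
Variables (R : pzRingType) (A : algType R).

Definition two_sided_ideal (I : set A) : Prop :=
  [/\ I 0, forall x y, I x -> I y -> I (x - y),
      forall a x, I x -> I (a * x) & forall a x, I x -> I (x * a)].

Definition ideal_gen (S : set A) : set A := smallest two_sided_ideal S.

Lemma ideal_gen_two_sided (S : set A) : two_sided_ideal (ideal_gen S).
Proof.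
split=> [J [[]] //|x y Ix Iy J SJ|a x Ix J SJ|a x Ix J SJ];
  have [[_ IB IMl IMr] _] := SJ.
- exact: IB (Ix J SJ) (Iy J SJ).
- exact: IMl (Ix J SJ).
- exact: IMr (Ix J SJ).
Qed.

Definition ideal_pred (S : set A) : A -> bool := fun x => `[< ideal_gen S x >].

Fact ideal_pred_zmod_closed S : zmod_closed (ideal_pred S).
Proof.
have [I0 IB _ _] := ideal_gen_two_sided S.
by split=> [|x y /asboolP Ix /asboolP Iy]; apply/asboolP => //; apply: IB.
Qed.

HB.instance Definition _ S :=
  GRing.isZmodClosed.Build A (ideal_pred S) (ideal_pred_zmod_closed S).

Definition ideal_zmod (S : set A) : zmodClosed A :=
  GRing.ZmodClosed.clone A (ideal_pred S) _.

End TwoSidedIdeal.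

Section AlgebraQuotient.
Variables (R : pzRingType) (A : algType R) (S : set A).

(* The quotient of A by the two-sided ideal generated by S.  Its additive group
   is the library's quotient; MathComp gives it a product only for commutative
   A.  It may be the zero ring, hence the pzRingType structure. *)
Definition alg_quot := Quotient.quot (ideal_zmod S).

HB.instance Definition _ : EqQuotient A (Quotient.equiv (ideal_zmod S)) alg_quot :=
  EqQuotient.on alg_quot.
HB.instance Definition _ := GRing.Zmodule.on alg_quot.

Definition alg_proj (x : A) : alg_quot := \pi_alg_quot x.

Lemma alg_proj_surj (q : alg_quot) : exists x, q = alg_proj x.
Proof. by exists (repr q); rewrite /alg_proj reprK. Qed.

Lemma alg_projP x y : alg_proj x = alg_proj y <-> ideal_gen S (x - y).
Proof.
by split=> [/eqP|Ixy]; [|apply/eqP]; rewrite /alg_proj -Quotient.idealrBE;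
  [move/asboolP|apply/asboolP].
Qed.

Lemma alg_projD x y : alg_proj (x + y) = alg_proj x + alg_proj y.
Proof. exact: (@Quotient.pi_add A (ideal_zmod S) x y). Qed.

Lemma alg_proj0 : alg_proj 0 = 0.
Proof. by apply: (addIr (alg_proj 0)); rewrite -alg_projD !add0r. Qed.

Let idealM x x' y y' : ideal_gen S (x - x') -> ideal_gen S (y - y') ->
  ideal_gen S (x * y - x' * y').
Proof.
move=> Ix Iy; have [I0 IB IMl IMr] := ideal_gen_two_sided S.
have -> : x * y - x' * y' = (x - x') * y - x' * (y' - y).
  by rewrite mulrBl mulrBr opprB addrA subrK.
have Iy' : ideal_gen S (y' - y) by rewrite -opprB -[- _]add0r; apply: (IB).
by apply: IB; [exact: IMr | exact: IMl].
Qed.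

Let repr_proj x : ideal_gen S (repr (alg_proj x) - x).
Proof. by apply/alg_projP; rewrite {1}/alg_proj reprK. Qed.

Definition alg_quot_one : alg_quot := alg_proj 1.
Definition alg_quot_mul (p q : alg_quot) : alg_quot := alg_proj (repr p * repr q).
Definition alg_quot_scale (c : R) (q : alg_quot) : alg_quot :=
  alg_proj (c *: repr q).

Let mulE x y : alg_quot_mul (alg_proj x) (alg_proj y) = alg_proj (x * y).
Proof. by apply/alg_projP; exact: idealM (repr_proj x) (repr_proj y). Qed.

Let scaleE c x : alg_quot_scale c (alg_proj x) = alg_proj (c *: x).
Proof.
apply/alg_projP; rewrite -scalerBr -[repr _ - x]mul1r scalerAl.
by have [_ _ IMl _] := ideal_gen_two_sided S; exact: IMl (repr_proj x).
Qed.

Fact alg_quot_mulA : associative alg_quot_mul.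
Proof.
move=> p q r; have [[x ->] [[y ->] [z ->]]] :=
  (alg_proj_surj p, (alg_proj_surj q, alg_proj_surj r)).
by rewrite !mulE mulrA.
Qed.

Fact alg_quot_mul1 : left_id alg_quot_one alg_quot_mul.
Proof. by move=> p; have [x ->] := alg_proj_surj p; rewrite mulE mul1r. Qed.

Fact alg_quot_mulr1 : right_id alg_quot_one alg_quot_mul.
Proof. by move=> p; have [x ->] := alg_proj_surj p; rewrite mulE mulr1. Qed.

Fact alg_quot_mulDl : left_distributive alg_quot_mul +%R.
Proof.
move=> p q r; have [[x ->] [[y ->] [z ->]]] :=
  (alg_proj_surj p, (alg_proj_surj q, alg_proj_surj r)).
by rewrite -alg_projD !mulE mulrDl alg_projD.
Qed.

Fact alg_quot_mulDr : right_distributive alg_quot_mul +%R.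
Proof.
move=> p q r; have [[x ->] [[y ->] [z ->]]] :=
  (alg_proj_surj p, (alg_proj_surj q, alg_proj_surj r)).
by rewrite -alg_projD !mulE mulrDr alg_projD.
Qed.

HB.instance Definition _ := GRing.Zmodule_isPzRing.Build alg_quot
  alg_quot_mulA alg_quot_mul1 alg_quot_mulr1 alg_quot_mulDl alg_quot_mulDr.

Fact alg_quot_scaleA a b q :
  alg_quot_scale a (alg_quot_scale b q) = alg_quot_scale (a * b) q.
Proof. by have [x ->] := alg_proj_surj q; rewrite !scaleE scalerA. Qed.

Fact alg_quot_scale1 : left_id 1 alg_quot_scale.
Proof. by move=> q; have [x ->] := alg_proj_surj q; rewrite scaleE scale1r. Qed.

Fact alg_quot_scaleDr : right_distributive alg_quot_scale +%R.
Proof.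
move=> c p q; have [[x ->] [y ->]] := (alg_proj_surj p, alg_proj_surj q).
by rewrite -alg_projD !scaleE scalerDr alg_projD.
Qed.

Fact alg_quot_scaleDl q : {morph alg_quot_scale^~ q : a b / a + b}.
Proof.
move=> a b; have [x ->] := alg_proj_surj q.
by rewrite !scaleE scalerDl alg_projD.
Qed.

HB.instance Definition _ := GRing.Zmodule_isLmodule.Build R alg_quot
  alg_quot_scaleA alg_quot_scale1 alg_quot_scaleDr alg_quot_scaleDl.

Lemma alg_proj1 : alg_proj 1 = 1.
Proof. by []. Qed.

Lemma alg_projM x y : alg_proj (x * y) = alg_proj x * alg_proj y.
Proof. by rewrite -mulE. Qed.

Lemma alg_projZ c x : alg_proj (c *: x) = c *: alg_proj x.
Proof. by rewrite -scaleE. Qed.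

Lemma alg_quot_scalerAl c (p q : alg_quot) : c *: (p * q) = (c *: p) * q.
Proof.
have [[x ->] [y ->]] := (alg_proj_surj p, alg_proj_surj q).
by rewrite -!(alg_projM, alg_projZ) scalerAl.
Qed.

Lemma alg_quot_scalerAr c (p q : alg_quot) : c *: (p * q) = p * (c *: q).
Proof.
have [[x ->] [y ->]] := (alg_proj_surj p, alg_proj_surj q).
by rewrite -!(alg_projM, alg_projZ) scalerAr.
Qed.

End AlgebraQuotient.

Section Envelope.
Variables (F : fieldType) (n : nat).

(* Product of the anti-Jordan triple system of n x n matrices. *)
Definition ajt (a b c : 'M[F]_n) : 'M[F]_n := a *m b *m c - c *m b *m a.

Lemma ajt_delta (i j k l m t : 'I_n) :
  ajt (delta_mx i j) (delta_mx k l) (delta_mx m t)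
  = ((j == k)%:R * (l == m)%:R) *: delta_mx i t
    - ((t == k)%:R * (l == i)%:R) *: delta_mx m j.
Proof.
have mul3 i1 j1 i2 j2 i3 j3 : delta_mx i1 j1 *m delta_mx i2 j2 *m delta_mx i3 j3
    = ((j1 == i2)%:R * (j2 == i3)%:R) *: delta_mx i1 j3 :> 'M[F]_n.
  rewrite mul_delta_mx_cond -scaler_nat -scalemxAl mul_delta_mx_cond.
  by rewrite -scaler_nat scalerA.
by rewrite /ajt !mul3.
Qed.

Lemma sum_delta_mxB (V : lmodType F) (g : 'I_n -> 'I_n -> V) (a b : F)
    (i j k l : 'I_n) :
  \sum_p \sum_q (a *: delta_mx i j - b *: delta_mx k l : 'M_n) p q *: g p q
  = a *: g i j - b *: g k l.
Proof.
have sum_delta (c : F) i0 j0 :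
    \sum_p \sum_q (c *: delta_mx i0 j0 : 'M_n) p q *: g p q = c *: g i0 j0.
  rewrite (bigD1 i0) //= (bigD1 j0) //= !mxE !eqxx mulr1.
  rewrite big1 ?addr0 => [|q /negPf qj]; last first.
    by rewrite !mxE qj andbF mulr0 scale0r.
  rewrite big1 ?addr0 // => p /negPf pi; apply: big1 => q _.
  by rewrite !mxE pi mulr0 scale0r.
rewrite -!sum_delta -sumrB; apply: eq_bigr => p _.
by rewrite -sumrB; apply: eq_bigr => q _; rewrite !mxE scalerBl.
Qed.

Definition env_gen (i j : 'I_n) : free_alg F ('I_n * 'I_n)%type :=
  free_gen F (i, j).

Definition env_rel (i j k l m t : 'I_n) : free_alg F ('I_n * 'I_n)%type :=
  env_gen i j * env_gen k l * env_gen m t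
  - env_gen m t * env_gen k l * env_gen i j
  - ((j == k)%:R * (l == m)%:R) *: env_gen i t
  + ((t == k)%:R * (l == i)%:R) *: env_gen m j.

Definition env_lin (a : 'M[F]_n) : free_alg F ('I_n * 'I_n)%type :=
  \sum_p \sum_q a p q *: env_gen p q.

(* The relations say exactly that matrix units satisfy abc - cba = <a, b, c>,
   with the right-hand side extended linearly to the generators. *)
Lemma env_relE i j k l m t : env_rel i j k l m t =
  env_gen i j * env_gen k l * env_gen m t
  - env_gen m t * env_gen k l * env_gen i j
  - env_lin (ajt (delta_mx i j) (delta_mx k l) (delta_mx m t)).
Proof.
rewrite ajt_delta /env_lin sum_delta_mxB /env_rel.
by rewrite opprB addrA addrAC.
Qed.

Definition env_ideal_gens : set (free_alg F ('I_n * 'I_n)%type) :=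
  [set x | exists i j k l m t, x = env_rel i j k l m t].

Definition envelope := alg_quot env_ideal_gens.

HB.instance Definition _ := GRing.PzRing.on envelope.
HB.instance Definition _ := GRing.Lmodule.on envelope.

Fact envelope_oner_neq0 : 1 != 0 :> envelope.
Proof.
have [eps [epsD epsN epsZ [eps1 epsM] eps_gen]] :=
  free_alg_augmentation F ('I_n * 'I_n)%type.
apply/eqP => e10.
have /alg_projP/(_ [set x | eps x = 0]) H :
  alg_proj env_ideal_gens 1 = alg_proj env_ideal_gens 0.
  by rewrite alg_proj0; exact: e10.
have {H} : eps (1 - 0) = 0.
  apply: H; split; last first.
    move=> _ [i [j [k [l [m [t ->]]]]]] /=.
    rewrite /env_rel /env_gen !(epsD, epsN, epsZ, epsM, eps_gen).
    by rewrite !(mulr0, oppr0, addr0).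
  have eps0 : eps 0 = 0 by apply: (addIr (eps 0)); rewrite -epsD !add0r.
  split => [|x y /= ex ey|a x /= ex|a x /= ex] //.
  - by rewrite epsD epsN ex ey subr0.
  - by rewrite epsM ex mulr0.
  - by rewrite epsM ex mul0r.
by move/eqP; rewrite subr0 eps1 oner_eq0.
Qed.

HB.instance Definition _ :=
  GRing.PzSemiRing_isNonZero.Build envelope envelope_oner_neq0.
HB.instance Definition _ := GRing.Lmodule_isLalgebra.Build F envelope
  (@alg_quot_scalerAl _ _ env_ideal_gens).
HB.instance Definition _ := GRing.Lalgebra_isAlgebra.Build F envelope
  (@alg_quot_scalerAr _ _ env_ideal_gens).

End Envelope.

(* Main.v *)
Require Import Defs.
From HB Require Import structures.
From mathcomp Require Import all_boot all_order all_algebra.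
From mathcomp.multinomials Require Import monalg.
Import GRing.Theory.
Local Open Scope ring_scope.

Set Implicit Arguments.
Unset Strict Implicit.
Unset Printing Implicit Defensive.

(** Why the theorem holds.

Write [phi] for the linear map from matrices to an algebra given by a family
[e i j], subject to phi(a)phi(b)phi(c) - phi(c)phi(b)phi(a) = phi(abc - cba).
Besides [phi = 0], the maps a |-> a and a |-> -a are solutions, and if [phi] is
a solution and z^2 = -1 then so is a |-> z phi(a^T): transposition changes the
sign of the triple product, and z^3 = -z changes it back.  This gives one
one-dimensional and four n-dimensional representations of the envelope.  They
assemble into the required isomorphism; what has to be shown is that they
detect every element of the envelope and that they are independent.

The symmetry [conj_units] (transpose and scale by z) exchanges the two pairs of
n-dimensional representations, so each computation is needed for one pair only.
The key is a hidden quadratic relation, [commuting_reversals]: in a word abcd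
one may reverse the first three letters and then the last three, or the other
way round, and the two results agree up to quadratic corrections.  Applied to
matrix units it yields
- e_ij e_kl = 0 when j <> k and i <> l ([mul_units_eq0]);
- e_ij e_jl does not depend on j when i <> l ([mul_units_mid]).
These imply that the cubic words P_iq = e_ij e_jl e_lq, with l <> i or j <> q,
depend on i and q alone ([odd_unitE]), and the defining relation itself becomes
e_kl = P_kl - z P'_lk, where P' is built from the conjugate family
([unit_decomp]).  With X_kq = e_kk P_kq one finds
e_kl P_pq = delta_lp X_kq and e_kl X_pq = delta_lp P_kq
([mul_unit_odd], [mul_unit_even]).  So (X + P)/2 and (X - P)/2 behave as matrix
units under left multiplication, and together with their conjugates and 1 they
span a left ideal containing 1, that is, the whole envelope.

The inverse of the isomorphism is therefore written down explicitly
([assemble]).  It is a left inverse of the joint representation since the two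
sides agree at 1 and are compatible with left multiplication by the generators;
it is a right inverse since each representation sends one of the four systems of
matrix units to the E_ij and kills the others ([map_assemble]). *)

(** * The universal property of the envelope *)

Definition unit_triples (F : fieldType) (B : algType F) n
  (e : 'I_n -> 'I_n -> B) : Prop :=
  forall i j k l m t,
  e i j * e k l * e m t - e m t * e k l * e i j
  = e i t *+ ((j == k) && (l == m)) - e m j *+ ((t == k) && (l == i)).

Lemma scale_andb (F : fieldType) (V : lmodType F) (b c : bool) (v : V) :
  (b%:R * c%:R) *: v = v *+ (b && c).
Proof. by rewrite -natrM mulnb scaler_nat. Qed.

(** The argument of [h] has the shape of a defining relation of the envelope; with
the generators for [x], [y], [z], [v], [w], a morphism out of the free algebra
kills it exactly when the images of the generators satisfy [unit_triples]. *)
Lemma lrmorph_rel (F : fieldType) (A B : algType F) (h : {lrmorphism A -> B})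
    (x y z v w : A) (b c b' c' : bool) :
  h (x * y * z - z * y * x - (b%:R * c%:R) *: v + (b'%:R * c'%:R) *: w)
  = h x * h y * h z - h z * h y * h x
    - (h v *+ (b && c) - h w *+ (b' && c')).
Proof.
rewrite !scale_andb rmorphD !rmorphB !rmorphMn !rmorphM.
by rewrite opprB addrA addrAC.
Qed.

Section FreeEval.
Variables (F : fieldType) (X : choiceType) (B : algType F) (u : X -> B).

Definition word_eval (w : {fmonom X}) : B := \prod_(x <- w) u x.

Fact word_eval_mmorphism : mmorphism word_eval.
Proof.
by split=> [w1 w2|]; rewrite /word_eval ?fmM ?big_cat // fm1 big_nil.
Qed.

HB.instance Definition _ :=
  monalg.isMultiplicative.Build {fmonom X} B word_eval word_eval_mmorphism.

Definition free_eval (x : free_alg F X) : B :=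
  mmap (GRing.in_alg B) word_eval x.

Fact free_eval_linear : linear free_eval.
Proof.
move=> c x y; rewrite [LHS]mmapD; congr (_ + _).
by rewrite [LHS]mmapZ /= mulr_algl.
Qed.

Fact free_eval_monoid : monoid_morphism free_eval.
Proof.
split=> [|x y]; first exact: mmap1.
apply: (@commr_mmap_is_multiplicative {fmonom X} F B (GRing.in_alg B) _ _).1.
by move=> g m m'; rewrite /GRing.comm /= mulr_algl mulr_algr.
Qed.

Lemma free_eval_gen x : free_eval (free_gen F x) = u x.
Proof.
by rewrite /free_eval [LHS]mmapU /= scale1r mul1r /word_eval fmU big_seq1.
Qed.

HB.instance Definition _ :=
  GRing.isLinear.Build F (free_alg F X) B _ free_eval free_eval_linear.
HB.instance Definition _ :=
  GRing.isMonoidMorphism.Build (free_alg F X) B free_eval free_eval_monoid.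

Lemma free_alg_ind (P : free_alg F X -> Prop) :
  P 1 -> (forall c x y, P x -> P y -> P (c *: x + y)) ->
  (forall a x, P x -> P (free_gen F a * x)) -> forall x, P x.
Proof.
move=> P1 PD PM x.
have P0 : P 0 by have := PD (-1) _ _ P1 P1; rewrite scaleN1r addNr.
have Pw (s : seq X) : P << FMonom s >>.
  elim: s => [|a s IHs]; first by have := P1; rewrite -fmoneE.
  have := PM a _ IHs.
  rewrite /free_gen [X in P X]malgM_def fgmulUU mulr1.
  have -> // : mmul (fmu a) (FMonom s) = FMonom (a :: s).
  by apply/val_inj; rewrite /= fmM fmU.
rewrite [x]monalgE; elim/big_ind: _ => // [y1 y2 Py1 Py2|[s] _].
  by have := PD 1 _ _ Py1 Py2; rewrite scale1r.
have scaleU (c : F) w : << c *g w >> = c *: << w >> :> {malg F[{fmonom X}]}.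
  by apply/malgP => w'; rewrite mcoeffZ !mcoeffU mulr_natr.
have := PD x@_(FMonom s) _ _ (Pw s) P0; rewrite addr0.
by congr P; apply/esym; apply: scaleU.
Qed.

End FreeEval.

Lemma alg_proj_rel (F : fieldType) (A : algType F) (S : classical_sets.set A)
    (x y z v w : A) (b c b' c' : bool) :
  alg_proj S (x * y * z - z * y * x - (b%:R * c%:R) *: v + (b'%:R * c'%:R) *: w)
  = alg_proj S x * alg_proj S y * alg_proj S z
    - alg_proj S z * alg_proj S y * alg_proj S x
    - (alg_proj S v *+ (b && c) - alg_proj S w *+ (b' && c')).
Proof.
have projB p q : alg_proj S (p - q) = alg_proj S p - alg_proj S q.
  by rewrite -scaleN1r alg_projD alg_projZ scaleN1r.
rewrite alg_projD !projB !alg_projM !alg_projZ !scale_andb.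
by rewrite opprB addrA addrAC.
Qed.

Section Lift.
Variables (F : fieldType) (n : nat).

Definition env_unit (i j : 'I_n) : envelope F n := alg_proj _ (env_gen F i j).

Lemma env_unitP : unit_triples env_unit.
Proof.
move=> i j k l m t; apply/eqP; rewrite -subr_eq0; apply/eqP.
have : alg_proj (@env_ideal_gens F n) (env_rel F i j k l m t) = 0.
  rewrite -alg_proj0; apply/alg_projP; rewrite subr0 => J [_]; apply.
  by exists i, j, k, l, m, t.
by rewrite /env_rel alg_proj_rel.
Qed.

Lemma envelope_lift (B : algType F) (u : 'I_n -> 'I_n -> B) :
  unit_triples u -> exists rho : {lrmorphism envelope F n -> B},
    forall i j, rho (env_unit i j) = u i j.
Proof.
move=> uP.
pose ev : {lrmorphism free_alg F ('I_n * 'I_n)%type -> B} :=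
  free_eval (fun x => u x.1 x.2).
have ev_gen i j : ev (env_gen F i j) = u i j by exact: free_eval_gen.
have ev_ideal x y : alg_proj (@env_ideal_gens F n) x = alg_proj _ y ->
  ev x = ev y.
  (* the ideal lies in every two-sided ideal containing the relations, in
     particular in the kernel of the evaluation *)
  move/alg_projP/(_ (fun x => ev x = 0)) => H; apply/eqP.
  rewrite -subr_eq0 -rmorphB; apply/eqP/H; split.
    split=> [|a b ea eb|a b eb|a b eb].
    - exact: rmorph0.
    - by rewrite rmorphB [X in X - _]ea [X in _ - X]eb subrr.
    - by rewrite rmorphM [X in _ * X]eb mulr0.
    - by rewrite rmorphM [X in X * _]eb mul0r.
  move=> _ [i [j [k [l [m [t ->]]]]]] /=.
  apply: etrans (lrmorph_rel ev _ _ _ _ _ _ _ _ _) _.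
  move: (uP i j k l m t); rewrite -!ev_gen => /eqP; rewrite -subr_eq0.
  by move/eqP.
pose rho (q : envelope F n) : B := ev (repr q).
have rhoE x : rho (alg_proj _ x) = ev x.
  by apply: ev_ideal; rewrite /alg_proj reprK.
have rho_lin : linear rho.
  move=> c p q; have [[x ->] [y ->]] := (alg_proj_surj p, alg_proj_surj q).
  rewrite -alg_projZ -alg_projD !rhoE.
  exact: linearP.
have rho_mon : monoid_morphism rho.
  split=> [|p q]; first by rewrite -alg_proj1 rhoE rmorph1.
  have [[x ->] [y ->]] := (alg_proj_surj p, alg_proj_surj q).
  by rewrite -alg_projM !rhoE rmorphM.
pose rhoL := GRing.isLinear.Build F (envelope F n) B _ rho rho_lin.
pose rhoM := GRing.isMonoidMorphism.Build (envelope F n) B rho rho_mon.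
pose Rho : {lrmorphism envelope F n -> B} := HB.pack rho rhoL rhoM.
by exists Rho => i j; rewrite /= rhoE.
Qed.

(** Only left multiplication by generators is required, so a left ideal
containing 1 is seen to be everything. *)
Lemma envelope_ind (P : envelope F n -> Prop) :
  P 1 -> (forall c x y, P x -> P y -> P (c *: x + y)) ->
  (forall i j x, P x -> P (env_unit i j * x)) -> forall x, P x.
Proof.
move=> P1 PD PM q; have [x ->] := alg_proj_surj q.
elim/free_alg_ind: x => [|c x y Px Py|[i j] x Px].
- exact: P1.
- by rewrite alg_projD alg_projZ; apply: PD.
- by rewrite alg_projM; apply: PM.
Qed.

End Lift.

(** * Consequences of the triple relations *)

Lemma neqF (T : eqType) (x y : T) :
  x != y -> ((x == y) = false) * ((y == x) = false).
Proof. by move=> xy; rewrite [y == x]eq_sym (negPf xy). Qed.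

(** Reversing the first three letters of [a * b * c * d] and then the last three
of the result leads to [c * d * a * b], and so does reversing in the opposite
order.  Comparing the corrections gives a relation of degree two. *)
Lemma commuting_reversals (B : pzRingType) (a b c d x y z w : B) :
  a * b * c - c * b * a = x -> b * a * d - d * a * b = y ->
  a * d * c - c * d * a = z -> b * c * d - d * c * b = w ->
  c * y + x * d = z * b + a * w.
Proof.
move=> <- <- <- <-; rewrite !(mulrBr, mulrBl) !mulrA.
by rewrite addrC addrA subrK [RHS]addrC addrA subrK.
Qed.

Lemma eqN_eq0 (F : fieldType) (V : lmodType F) (x : V) :
  (2%:R : F) != 0 -> x = - x -> x = 0.
Proof.
move=> two0 /eqP; rewrite -subr_eq0 opprK -mulr2n -scaler_nat scaler_eq0.
by rewrite (negPf two0) => /eqP.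
Qed.

Definition other n (i : 'I_n) : 'I_n :=
  if [pick j | j != i] is Some j then j else i.

Lemma otherP n (i : 'I_n) : (1 < n)%N -> other i != i.
Proof.
move=> n_gt1; rewrite /other; case: pickP => // all_i.
have: (#|'I_n| <= 1)%N.
  have eq_i j : j = i by apply/eqP/negbFE/all_i.
  by apply/fintype_le1P => j k; rewrite (eq_i j) (eq_i k).
by rewrite card_ord leqNgt n_gt1.
Qed.

Definition conj_units (F : fieldType) (B : algType F) n (z : F)
  (e : 'I_n -> 'I_n -> B) (i j : 'I_n) : B := z *: e j i.

(** The component of [e i q] in the representations [e i j |-> +-E_ij]: it maps
to [+-E_iq] there, and to 0 where the indices are transposed, because the middle
factor is off the diagonal. *)
Definition odd_unit (F : fieldType) (B : algType F) n
  (e : 'I_n -> 'I_n -> B) (i q : 'I_n) : B :=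
  e i i * e i (other i) * e (other i) q.

Definition even_unit (F : fieldType) (B : algType F) n
  (e : 'I_n -> 'I_n -> B) (i q : 'I_n) : B :=
  e i i * odd_unit e i q.

(** For [s = 1] or [s = -1], the matrix units of the block on which [e i j] acts
as [s * E_ij]: the even and odd units are their sum and difference over the two
signs. *)
Definition half_unit (F : fieldType) (B : algType F) n (s : F)
  (e : 'I_n -> 'I_n -> B) (i j : 'I_n) : B :=
  2%:R^-1 *: (even_unit e i j + s *: odd_unit e i j).

Definition unit_comb (F : fieldType) (B : algType F) n
  (U : 'I_n -> 'I_n -> B) (A : 'M[F]_n) : B := \sum_i \sum_j A i j *: U i j.

Lemma unit_combP (F : fieldType) (B : algType F) n
  (U : 'I_n -> 'I_n -> B) : linear (unit_comb U).
Proof.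
move=> c A A'; rewrite /unit_comb scaler_sumr -big_split; apply: eq_bigr => i _.
rewrite scaler_sumr -big_split; apply: eq_bigr => j _.
by rewrite !mxE scalerDl scalerA.
Qed.

Lemma unit_comb_delta (F : fieldType) (B : algType F) n
  (U : 'I_n -> 'I_n -> B) (c : F) i j :
  unit_comb U (c *: delta_mx i j) = c *: U i j.
Proof.
rewrite /unit_comb (bigD1 i) //= (bigD1 j) //= !mxE !eqxx mulr1.
rewrite big1 ?addr0 => [|q /negPf qj]; last first.
  by rewrite !mxE qj andbF mulr0 scale0r.
rewrite big1 ?addr0 // => p /negPf pi; apply: big1 => q _.
by rewrite !mxE pi mulr0 scale0r.
Qed.

(** If [U] behaves as a system of matrix units under left multiplication by [x],
then [unit_comb U] turns [x] into multiplication by a matrix. *)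
Lemma mul_unit_comb (F : fieldType) (B : algType F) n
    (U : 'I_n -> 'I_n -> B) (x : B) (c : F) k l (A : 'M[F]_n) :
  (forall p q, x * U p q = (c *: U k q) *+ (l == p)) ->
  x * unit_comb U A = unit_comb U (c *: delta_mx k l *m A).
Proof.
move=> xU; have row p q : (c *: delta_mx k l *m A) p q = c * A l q *+ (p == k).
  rewrite -scalemxAl mxE mxE (bigD1 l) //= mxE eqxx andbT.
  rewrite big1 ?addr0 => [|j jl].
    by rewrite mulrA mulr_natr mulrnAl.
  by rewrite mxE (negPf jl) andbF mul0r.
rewrite /unit_comb mulr_sumr (bigD1 l) //= [RHS](bigD1 k) //=.
rewrite [X in _ + X]big1 => [|p pl]; last first.
  rewrite mulr_sumr big1 // => q _.
  by rewrite -scalerAr xU eq_sym (negPf pl) scaler0.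
rewrite [X in _ = _ + X]big1 => [|p pk]; last first.
  by rewrite big1 // => q _; rewrite row (negPf pk) scale0r.
rewrite !addr0 mulr_sumr; apply: eq_bigr => q _.
by rewrite -scalerAr xU row !eqxx scalerA mulrC.
Qed.

Section TripleRelations.
Variables (F : fieldType) (B : algType F) (n : nat).
Hypotheses (two_neq0 : (2%:R : F) != 0) (n_gt1 : (1 < n)%N).

Section OneFamily.
Variable e : 'I_n -> 'I_n -> B.
Hypothesis eP : unit_triples e.

(** In [commuting_reversals] with a = E_ij, b = E_jl, c = E_lj, d = E_kl, the
only nonzero triple products are abc = E_ij and dcb = E_kl, which enter with
opposite signs: the product equals its own opposite. *)
Lemma mul_units_eq0 i j k l : j != k -> i != l -> e i j * e k l = 0.
Proof.
move=> jk il; apply: (eqN_eq0 two_neq0).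
have := commuting_reversals (eP i j j l l j) (eP j l i j k l)
                            (eP i j k l l j) (eP j l l j k l).
rewrite !eqxx !(neqF jk, neqF il).
by rewrite !andbF /= !mulr0n !mulr1n !(subr0, sub0r) mulr0 mul0r !add0r mulrN.
Qed.

(** Let [j] and [p] be distinct.  In [commuting_reversals] with a = E_ij,
b = E_jp, c = E_pp, d = E_pl, the only nonzero triple products are abc = E_ip
and bcd = E_jl, provided that [p != i]; otherwise [j != i] and the roles of [j]
and [p] can be exchanged. *)
Lemma mul_units_mid i j p l : i != l -> e i j * e j l = e i p * e p l.
Proof.
have half : forall j p, j != p -> p != i -> i != l ->
  e i j * e j l = e i p * e p l.
  move=> {}j {}p jp pi il.
  have := commuting_reversals (eP i j j p p p) (eP j p i j p l)
                              (eP i j p l p p) (eP j p p p p l).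
  rewrite !eqxx !(neqF jp, neqF pi, neqF il) !andbF /=.
  by rewrite !mulr0n !mulr1n !(subr0, sub0r) mulr0 mul0r !add0r => <-.
have [-> //|jp il] := eqVneq j p.
have [pi|pi] := eqVneq p i; last exact: half.
by symmetry; apply: half => //; rewrite ?pi in jp *; rewrite // eq_sym.
Qed.

(** By [mul_units_mid], [j] is free as long as [l != i], and [l] as long as
[j != q].  Excluded is e_iq e_qi e_iq, which also has a component on the
transposed side. *)
Lemma odd_unitE i j l q : (l != i) || (j != q) ->
  odd_unit e i q = e i j * e j l * e l q.
Proof.
rewrite /odd_unit; set o := other i; have oi : o != i by exact: otherP.
have mid_o (j' : 'I_n) : e i i * e i o = e i j' * e j' o.
  by apply: mul_units_mid; rewrite eq_sym.
have right (j' : 'I_n) : j' != q ->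
    e i i * e i o * e o q = e i j' * e j' l * e l q.
  by move=> j'q; rewrite (mid_o j') -!mulrA (mul_units_mid o l j'q).
case/orP => [li|]; last exact: right.
by rewrite (right (other q)) ?otherP // (mul_units_mid _ j) 1?eq_sym.
Qed.

Lemma mul_odd_unit_eq0 i q k l : q != k -> odd_unit e i q * e k l = 0.
Proof.
move=> qk; rewrite (@odd_unitE i (other q) (other l)) ?(otherP q) ?orbT //.
by rewrite -mulrA (mul_units_eq0 qk) ?mulr0 // otherP.
Qed.

Lemma mul_unit_odd_eq0 k l p q : l != p -> e k l * odd_unit e p q = 0.
Proof.
move=> lp; rewrite (@odd_unitE p (other k) (other p)) ?otherP //.
by rewrite !mulrA (mul_units_eq0 lp) ?mul0r // eq_sym otherP.
Qed.

End OneFamily.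

(** Transposition reverses products and so negates the triple product, and
[z ^ 3 = - z] compensates for it. *)
Lemma conj_unitsP (z : F) (e : 'I_n -> 'I_n -> B) :
  z * z = -1 -> unit_triples e -> unit_triples (conj_units z e).
Proof.
move=> zz eP i j k l m t; rewrite /conj_units.
rewrite -!(scalerAl, scalerAr) !scalerA -!mulrA zz mulrN1 -scalerBr !mulrA.
rewrite scaleNr -scalerN opprB eP scalerBr !scalerMnr.
rewrite [l == i]eq_sym [m == l]eq_sym [k == j]eq_sym [k == t]eq_sym.
by rewrite andbC [(t == k) && _]andbC.
Qed.

Section Conjugate.
Variables (z : F) (e : 'I_n -> 'I_n -> B).
Hypotheses (zz : z * z = -1) (eP : unit_triples e).
Let e' := conj_units z e.
Let e'P : unit_triples e' := conj_unitsP zz eP.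

Lemma unit_of_conj i j : e i j = - z *: e' j i.
Proof. by rewrite scalerA mulNr zz opprK scale1r. Qed.

(** This is the defining relation for e_kj, e_jl', e_l'l with l' <> k and
j <> l: the first product is an odd unit, the reversed one is an odd unit of the
conjugate family up to the factor z^3 = -z, and one term of the right-hand side
vanishes. *)
Lemma unit_decomp k l : e k l = odd_unit e k l - z *: odd_unit e' l k.
Proof.
have [ok ol] := (otherP k n_gt1, otherP l n_gt1).
have := eP k (other l) (other l) (other k) (other k) l.
rewrite !eqxx !(neqF ol) mulr0n mulr1n subr0.
rewrite -(odd_unitE eP) ?ok // => <-; congr (_ - _).
rewrite (@odd_unitE _ e'P l (other k) (other l)) ?ol //.
rewrite /e' /conj_units -!(scalerAl, scalerAr) !scalerA -!mulrA.
by rewrite zz mulrN1 mulrN zz opprK scale1r.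
Qed.

(** The remaining part of [e k r] is a conjugate odd unit with last index [k],
while [e i q] is, up to a scalar, the conjugate unit with first index [q]. *)
Lemma odd_unit_absorb k r i q :
  k != q -> odd_unit e k r * e i q = e k r * e i q.
Proof.
move=> kq; rewrite [in RHS]unit_decomp mulrBl -scalerAl.
rewrite [X in _ - _ *: (_ * X)]unit_of_conj -scalerAr.
by rewrite (mul_odd_unit_eq0 e'P) // !scaler0 subr0.
Qed.

Lemma mul_unit_odd_off k p q j :
  k != q -> e k p * odd_unit e p q = e k j * e j q.
Proof.
move=> kq; have op := otherP p n_gt1.
rewrite (@odd_unitE _ eP p (other k) (other p)) ?op // !mulrA.
rewrite -(@odd_unitE _ eP k p (other k)) ?otherP // odd_unit_absorb //.
exact: mul_units_mid.
Qed.

(** Independence of [p] lets [even_unit] be computed through any convenient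
intermediate index. *)
Lemma even_unitE k p q : even_unit e k q = e k p * odd_unit e p q.
Proof.
rewrite /even_unit.
have [<-|kq] := eqVneq k q.
  have diag p' : e k p' * odd_unit e p' k =
     e k k * e k (other k) * e (other k) k * e k k.
    rewrite (@odd_unitE _ eP p' (other k) k) ?(otherP k) ?orbT //.
    rewrite !mulrA (@mul_units_mid _ eP k p' k) //.
    by rewrite eq_sym otherP.
  by rewrite !diag.
by rewrite !(mul_unit_odd_off _ k kq).
Qed.

Lemma mul_unit_odd k l p q :
  e k l * odd_unit e p q = even_unit e k q *+ (l == p).
Proof.
have [->|lp] := eqVneq l p; first by rewrite -even_unitE.
by rewrite mul_unit_odd_eq0.
Qed.

(** The intermediate index [other k] makes the product vanish when [l != p], and
puts it in the form of [odd_unitE] when [l = p]. *)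
Lemma mul_unit_even k l p q :
  e k l * even_unit e p q = odd_unit e k q *+ (l == p).
Proof.
have [ok op] := (otherP k n_gt1, otherP p n_gt1).
rewrite (even_unitE p (other k)) mulrA.
have [->|lp] := eqVneq l p; last first.
  by rewrite (mul_units_eq0 eP lp) ?mul0r // eq_sym.
have [<-{q}|pq] := eqVneq p q.
  (* in the word e_kp e_ps e_st e_ts e_sp, with s = other k and t = other p, the
     first three letters form an odd unit, which before e_ts acts like e_kt *)
  rewrite (@odd_unitE _ eP (other k) (other p) (other k)) ?op ?orbT // !mulrA.
  rewrite -(@odd_unitE _ eP k p (other k)) ?ok // odd_unit_absorb 1?eq_sym //.
  by rewrite -(@odd_unitE _ eP k (other p) (other k)) ?ok.
rewrite -mulrA (@mul_unit_odd_off p (other k) q (other k)) // mulrA.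
by rewrite -(@odd_unitE _ eP k p (other k)) ?ok.
Qed.

(** Left multiplication by [e k l] exchanges even and odd units, so their
combinations with [s * s = 1] are eigenvectors of this exchange. *)
Lemma mul_unit_half s k l p q : s * s = 1 ->
  e k l * half_unit s e p q = (s *: half_unit s e k q) *+ (l == p).
Proof.
move=> ss; rewrite /half_unit -scalerAr mulrDr -scalerAr.
rewrite mul_unit_odd mul_unit_even; case: (l == p); last first.
  by rewrite !mulr0n scaler0 addr0 scaler0.
rewrite !mulr1n [RHS]scalerA mulrC -scalerA; congr (_ *: _).
by rewrite scalerDr scalerA ss scale1r addrC.
Qed.

Lemma mul_unit_half_comb s k l A : s * s = 1 ->
  e k l * unit_comb (half_unit s e) A
  = unit_comb (half_unit s e) (s *: delta_mx k l *m A).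
Proof. by move=> ss; apply: mul_unit_comb => p q; apply: mul_unit_half. Qed.

Lemma half_unitB i j :
  half_unit 1 e i j - half_unit (-1) e i j = odd_unit e i j.
Proof.
rewrite /half_unit -scalerBr scaleN1r scale1r opprB [_ - _]addrC addrACA subrr.
by rewrite add0r -mulr2n -scaler_nat scalerA mulVf // scale1r.
Qed.

End Conjugate.

End TripleRelations.

(** * The representations by matrix units *)

Section Map.
Variables (F : fieldType) (B T : algType F) (n : nat).
Variables (rho : {lrmorphism B -> T}).
Variables (e : 'I_n -> 'I_n -> B) (u : 'I_n -> 'I_n -> T).
Hypothesis rho_e : forall i j, rho (e i j) = u i j.

Lemma map_half_unit s i j : rho (half_unit s e i j) = half_unit s u i j.
Proof.
by rewrite linearZ linearD linearZ /= /even_unit /odd_unit !rmorphM /= !rho_e.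
Qed.

Lemma map_unit_comb A : rho (unit_comb e A) = unit_comb u A.
Proof.
rewrite linear_sum; apply: eq_bigr => i _; rewrite linear_sum.
by apply: eq_bigr => j _; rewrite linearZ /= rho_e.
Qed.

End Map.

Section MatrixModel.
Variables (F : fieldType) (m : nat).
Hypothesis (m_gt1 : (1 < m.+1)%N).

(** The size is a successor because the algebra structure requires a nonzero
ring. *)
Definition signed_delta (s : F) (i j : 'I_m.+1) : 'M[F]_m.+1 :=
  s *: delta_mx i j.

Lemma mul_signed_delta s i j k l :
  signed_delta s i j * signed_delta s k l
  = (s * s) *: delta_mx i l *+ (j == k).
Proof.
rewrite -scalerAl -scalerAr scalerA -[delta_mx i j * _]/(_ *m _).
by rewrite mul_delta_mx_cond scalerMnr.
Qed.

Lemma unit_comb_signed_delta s A : unit_comb (signed_delta s) A = s *: A.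
Proof.
rewrite [A in RHS]matrix_sum_delta scaler_sumr; apply: eq_bigr => i _.
by rewrite scaler_sumr; apply: eq_bigr => j _; rewrite !scalerA mulrC.
Qed.

Lemma signed_delta_triples s : s * s = 1 -> unit_triples (signed_delta s).
Proof.
move=> ss i j k l p t.
have mul3 a1 b1 a2 b2 a3 b3 : signed_delta s a1 b1 * signed_delta s a2 b2 *
    signed_delta s a3 b3 = signed_delta s a1 b3 *+ ((b1 == a2) && (b2 == a3)).
  rewrite mul_signed_delta ss scale1r /signed_delta mulrnAl -scalerAr.
  rewrite -[delta_mx a1 b2 * _]/(_ *m _) mul_delta_mx_cond -scalerMnr -mulrnA.
  by rewrite mulnb andbC.
by rewrite !mul3.
Qed.

(** The scalar is 1 when the signs agree and 0 when they are opposite. *)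
Lemma half_signed_delta s s' i j : s * s = 1 ->
  half_unit s' (signed_delta s) i j = (2%:R^-1 * (1 + s' * s)) *: delta_mx i j.
Proof.
move=> ss; have odd_s q r : odd_unit (signed_delta s) q r = signed_delta s q r.
  rewrite /odd_unit !mul_signed_delta eqxx ss scale1r /signed_delta.
  rewrite -scalerAr -[delta_mx _ _ * _]/(_ *m _).
  by rewrite mul_delta_mx.
rewrite /half_unit /even_unit !odd_s mul_signed_delta eqxx ss scalerA -scalerDl.
by rewrite scalerA.
Qed.

(** Already the first two factors of an odd unit, E_ii and E_li with [l != i],
have product 0. *)
Lemma half_conj_signed_delta s s' y i j :
  half_unit s' (conj_units y (signed_delta s)) i j = 0.
Proof.
have odd0 q r : odd_unit (conj_units y (signed_delta s)) q r = 0.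
  rewrite /odd_unit /conj_units /signed_delta -!(scalerAl, scalerAr).
  rewrite -[delta_mx q q * _]/(_ *m _) mul_delta_mx_0; last first.
    by rewrite eq_sym otherP.
  by rewrite mul0r !scaler0.
by rewrite /half_unit /even_unit !odd0 mulr0 scaler0 addr0 scaler0.
Qed.

End MatrixModel.

(** * The decomposition *)

Section Decomposition.
Variables (F : fieldType) (A : algType F) (m : nat) (z : F).
Variable e : 'I_m.+1 -> 'I_m.+1 -> A.
Hypotheses (two_neq0 : (2%:R : F) != 0) (n_gt1 : (1 < m.+1)%N).
Hypotheses (zz : z * z = -1) (eP : unit_triples e).
Let e' := conj_units z e.
Let e'P : unit_triples e' := conj_unitsP zz eP.

(** The idempotent of the one-dimensional summand: 1 minus the identities of the
four matrix blocks. *)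
Definition rest : A :=
  1 - (unit_comb (half_unit 1 e) 1%:M + unit_comb (half_unit (-1) e) 1%:M
       + unit_comb (half_unit 1 e') 1%:M + unit_comb (half_unit (-1) e') 1%:M).

Definition assemble
    (w : F^o * 'M[F]_m.+1 * 'M[F]_m.+1 * 'M[F]_m.+1 * 'M[F]_m.+1) : A :=
  w.1.1.1.1 *: rest + (unit_comb (half_unit 1 e) w.1.1.1.2
    + unit_comb (half_unit (-1) e) w.1.1.2
    + unit_comb (half_unit 1 e') w.1.2 + unit_comb (half_unit (-1) e') w.2).

Let mul_e s k l M : s * s = 1 ->
  e k l * unit_comb (half_unit s e) M
  = unit_comb (half_unit s e) (s *: delta_mx k l *m M).
Proof. exact: (mul_unit_half_comb two_neq0 n_gt1 zz eP). Qed.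

Let mul_e' s k l M : s * s = 1 ->
  e k l * unit_comb (half_unit s e') M
  = unit_comb (half_unit s e') ((- z * s) *: delta_mx l k *m M).
Proof.
move=> ss; apply: mul_unit_comb => p q.
have half := mul_unit_half two_neq0 n_gt1 zz e'P l k p q ss.
rewrite (unit_of_conj e zz k l) -scalerAl -[conj_units z e l k]/(e' l k) half.
by rewrite -scalerMnr scalerA.
Qed.

Let s1 : (1 : F) * 1 = 1 := mulr1 1.
Let sN1 : (-1 : F) * -1 = 1. Proof. by rewrite mulrNN mulr1. Qed.

(** Subtracting the block identities from 1 leaves, after multiplication by
[e k l], the two sides of [unit_decomp]. *)
Lemma mul_unit_rest k l : e k l * rest = 0.
Proof.
rewrite /rest mulrBr mulr1 !mulrDr !mul_e // !mul_e' // !mulmx1.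
rewrite !unit_comb_delta mulr1 mulrN1 opprK scale1r scaleN1r scaleNr.
rewrite half_unitB // -addrA -[z *: half_unit (-1) _ _ _]opprK -opprD.
rewrite -scalerBr half_unitB //.
rewrite [e k l](unit_decomp n_gt1 zz eP).
exact: subrr.
Qed.

Lemma mul_unit_assemble (rho0 : {lrmorphism A -> F^o})
    (r1 r2 r3 r4 : {lrmorphism A -> 'M[F]_m.+1}) k l w :
  rho0 (e k l) = 0 ->
  r1 (e k l) = signed_delta 1 k l -> r2 (e k l) = signed_delta (-1) k l ->
  r3 (e k l) = conj_units (- z) (signed_delta 1) k l ->
  r4 (e k l) = conj_units (- z) (signed_delta (-1)) k l ->
  assemble ((rho0 (e k l), r1 (e k l), r2 (e k l), r3 (e k l), r4 (e k l)) * w)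
  = e k l * assemble w.
Proof.
move=> -> -> -> -> ->; case: w => [[[[c M1] M2] M3] M4].
rewrite /assemble /= mul0r scale0r add0r mulrDr -scalerAr mul_unit_rest.
rewrite scaler0 add0r !mulrDr !mul_e // !mul_e' //.
by rewrite /conj_units /signed_delta !scalerA.
Qed.

Lemma assembleP : linear assemble.
Proof.
move=> c v w; rewrite /assemble /= !unit_combP; move: rest => r.
rewrite !scalerDr scalerA [X in X + _ = _]scalerDl.
do 3![rewrite [RHS]addrACA; congr (_ + _)].
by rewrite [RHS]addrACA.
Qed.

(** The coefficients say how a representation acts on the four blocks; their sum
is 1 exactly when the representation kills [rest]. *)
Lemma map_assemble (rho : {lrmorphism A -> 'M[F]_m.+1}) (c1 c2 c3 c4 : F) w :
  (forall i j, rho (half_unit 1 e i j) = signed_delta c1 i j) ->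
  (forall i j, rho (half_unit (-1) e i j) = signed_delta c2 i j) ->
  (forall i j, rho (half_unit 1 e' i j) = signed_delta c3 i j) ->
  (forall i j, rho (half_unit (-1) e' i j) = signed_delta c4 i j) ->
  c1 + c2 + c3 + c4 = 1 ->
  rho (assemble w) = c1 *: w.1.1.1.2 + c2 *: w.1.1.2 + c3 *: w.1.2 + c4 *: w.2.
Proof.
move=> h1 h2 h3 h4 c_sum.
have rest0 : rho rest = 0.
  rewrite /rest rmorphB rmorph1 !rmorphD /=.
  rewrite (map_unit_comb h1) (map_unit_comb h2) (map_unit_comb h3).
  rewrite (map_unit_comb h4) !unit_comb_signed_delta -!scalerDl c_sum.
  by rewrite scale1r subrr.
rewrite /assemble linearD linearZ /= rest0 scaler0 add0r !rmorphD /=.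
rewrite (map_unit_comb h1) (map_unit_comb h2) (map_unit_comb h3).
by rewrite (map_unit_comb h4) !unit_comb_signed_delta.
Qed.

Lemma map_assemble_signed (rho : {lrmorphism A -> 'M[F]_m.+1}) (s : F) w :
  s * s = 1 -> (forall i j, rho (e i j) = signed_delta s i j) ->
  rho (assemble w)
  = (2%:R^-1 * (1 + s)) *: w.1.1.1.2 + (2%:R^-1 * (1 - s)) *: w.1.1.2.
Proof.
move=> ss rho_e.
have rho_e' i j : rho (e' i j) = conj_units z (signed_delta s) i j.
  by rewrite linearZ /= rho_e.
rewrite (@map_assemble rho (2%:R^-1 * (1 + s)) (2%:R^-1 * (1 - s)) 0 0).
- by rewrite !scale0r !addr0.
- by move=> i j; rewrite (map_half_unit rho_e) half_signed_delta // mul1r.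
- by move=> i j; rewrite (map_half_unit rho_e) half_signed_delta // mulN1r.
- move=> i j; rewrite (map_half_unit rho_e') half_conj_signed_delta //.
  by rewrite /signed_delta scale0r.
- move=> i j; rewrite (map_half_unit rho_e') half_conj_signed_delta //.
  by rewrite /signed_delta scale0r.
- by rewrite !addr0 -mulrDr addrACA subrr addr0 -mulr2n mulVf.
Qed.

Lemma map_assemble_conj (rho : {lrmorphism A -> 'M[F]_m.+1}) (s : F) w :
  s * s = 1 ->
  (forall i j, rho (e i j) = conj_units (- z) (signed_delta s) i j) ->
  rho (assemble w)
  = (2%:R^-1 * (1 + s)) *: w.1.2 + (2%:R^-1 * (1 - s)) *: w.2.
Proof.
move=> ss rho_e.
have rho_e' i j : rho (e' i j) = signed_delta s i j.
  by rewrite linearZ /= rho_e /conj_units scalerA mulrN zz opprK scale1r.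
rewrite (@map_assemble rho 0 0 (2%:R^-1 * (1 + s)) (2%:R^-1 * (1 - s))).
- by rewrite !scale0r !add0r.
- move=> i j; rewrite (map_half_unit rho_e) half_conj_signed_delta //.
  by rewrite /signed_delta scale0r.
- move=> i j; rewrite (map_half_unit rho_e) half_conj_signed_delta //.
  by rewrite /signed_delta scale0r.
- by move=> i j; rewrite (map_half_unit rho_e') half_signed_delta // mul1r.
- by move=> i j; rewrite (map_half_unit rho_e') half_signed_delta // mulN1r.
- by rewrite addr0 add0r -mulrDr addrACA subrr addr0 -mulr2n mulVf.
Qed.

Lemma map_assemble0 (rho : {lrmorphism A -> F^o}) w :
  (forall i j, rho (e i j) = 0) -> rho (assemble w) = w.1.1.1.1.
Proof.
move=> rho_e; have rho_e' i j : rho (e' i j) = 0.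
  by rewrite linearZ /= rho_e scaler0.
have comb0 s (g : 'I_m.+1 -> 'I_m.+1 -> A) M : (forall i j, rho (g i j) = 0) ->
    rho (unit_comb (half_unit s g) M) = 0.
  move=> rho_g; have rho_h i j : rho (half_unit s g i j) = 0.
    rewrite (map_half_unit (u := fun _ _ => 0)) //.
    by rewrite /half_unit /even_unit /odd_unit !mulr0 scaler0 addr0 scaler0.
  rewrite (map_unit_comb (u := fun _ _ => 0)) //.
  by rewrite /unit_comb big1 // => i _; rewrite big1 // => j _; rewrite scaler0.
rewrite /assemble /rest linearD linearZ rmorphB rmorph1 !rmorphD /=.
by rewrite !comb0 // !addr0 subr0 [LHS]mulr1.
Qed.

End Decomposition.

Theorem envelope_decomposition (F : fieldType) (m : nat) (z : F) :
  (2%:R : F) != 0 -> (1 < m.+1)%N -> z * z = -1 ->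
  exists f : envelope F m.+1 ->
    (F^o * 'M[F]_m.+1 * 'M[F]_m.+1 * 'M[F]_m.+1 * 'M[F]_m.+1)%type,
  [/\ monoid_morphism f, linear f & bijective f].
Proof.
move=> two_neq0 n_gt1 zz.
pose A := envelope F m.+1; pose e := @env_unit F m.+1.
have eP : unit_triples e := @env_unitP F m.+1.
pose e' := conj_units z e.
have [s1 sN1] : (1 : F) * 1 = 1 /\ (-1 : F) * -1 = 1 by rewrite mulrNN mulr1.
have NzNz : - z * - z = -1 by rewrite mulrNN.
have [rho0 rho0E] : exists rho : {lrmorphism A -> F^o},
    forall i j, rho (e i j) = 0.
  apply: (@envelope_lift F m.+1 F^o (fun _ _ => 0)) => i j k l p t.
  by rewrite !mulr0 !mul0rn subr0.
have lift s : s * s = 1 -> exists rho : {lrmorphism A -> 'M[F]_m.+1},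
    forall i j, rho (e i j) = signed_delta s i j.
  by move=> ss; apply: envelope_lift; apply: signed_delta_triples.
(* scaling by - z here makes the conjugate family e' act as the signed E_ij *)
have lift' s : s * s = 1 -> exists rho : {lrmorphism A -> 'M[F]_m.+1},
    forall i j, rho (e i j) = conj_units (- z) (signed_delta s) i j.
  move=> ss; apply: envelope_lift; apply: conj_unitsP => //.
  exact: signed_delta_triples.
have [[r1 r1E] [r2 r2E]] := (lift _ s1, lift _ sN1).
have [[r3 r3E] [r4 r4E]] := (lift' _ s1, lift' _ sN1).
pose f a := (rho0 a, r1 a, r2 a, r3 a, r4 a).
have f_monoid : monoid_morphism f.
  by split=> [|a b]; rewrite /f ?rmorph1 // !rmorphM.
have f_linear : linear f by move=> c a b; rewrite /f !linearP.
exists f; split=> //.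
exists (assemble z e) => [a|].
  elim/envelope_ind: a => [|c a b IHa IHb|k l a IH].
  - rewrite /f !rmorph1 /assemble /= scale1r; exact: subrK.
  - by rewrite f_linear assembleP IHa IHb.
  - by rewrite f_monoid.2 mul_unit_assemble ?IH.
have half2 : 2%:R^-1 * (1 + 1) = 1 :> F by rewrite -mulr2n mulVf.
move=> w; rewrite /f (map_assemble0 z w rho0E).
rewrite (map_assemble_signed z two_neq0 n_gt1 w s1 r1E).
rewrite (map_assemble_signed z two_neq0 n_gt1 w sN1 r2E).
rewrite (map_assemble_conj two_neq0 n_gt1 zz w s1 r3E).
rewrite (map_assemble_conj two_neq0 n_gt1 zz w sN1 r4E).
rewrite opprK subrr half2 mulr0 !scale1r !scale0r !(add0r, addr0).
by case: w => [[[[]]]].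
Qed.

Theorem theorem6p1 (F : closedFieldType) (n : nat) :
  [pchar F] =i pred0 -> (1 < n)%N ->
  exists f : envelope F n ->
      (F^o * 'M[F]_n * 'M[F]_n * 'M[F]_n * 'M[F]_n)%type,
    [/\ monoid_morphism f, linear f & bijective f].
Proof.
case: n => // m pchar0 n_gt1.
have two_neq0 : (2%:R : F) != 0 by rewrite ((pcharf0P F).1 pchar0).
(* the polynomial 'X^2 + 1 *)
have [z zz] := @solve_monicpoly F 2 (fun i => - (i == 0)%:R) isT.
have {}zz : z * z = -1.
  by rewrite -expr2 zz big_ord_recl big_ord1 /= expr0 mulr1 oppr0 mul0r addr0.
exact: envelope_decomposition two_neq0 n_gt1 zz.
Qed.
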